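(* Let $G=(V,E)$ be the Soccer Ball Graph (SBG). The minimum cardinality of an Identifying Code Set of $G$ is at least nine; in other words, no set of at most eight vertices of $G$ is an Identifying Code Set of $G$.
   Context: For a finite undirected simple graph $G=(V,E)$ and $v\in V$, let $N(v)$ be the set of vertices adjacent to $v$ and $N^+(v)=\{v\}\cup N(v)$. A set $V'\subseteq V$ is an Identifying Code Set (ICS) of $G$ if $N^+(v)\cap V'\neq\varnothing$ for every $v\in V$, and $N^+(v)\cap V'\neq N^+(w)\cap V'$ for all $v,w\in V$ with $v\ne w$. A Minimum Identifying Code Set (MICS) is an ICS of smallest cardinality. The Soccer Ball Graph (SBG) has 32 vertices corresponding to the 20 hexagonal and 12 pentagonal faces of a truncated icosahedron, two vertices being adjacent iff the corresponding faces share a boundary edge (90 edges). Explicitly, $V=P\cup H$ with $P=\{P_{1,1}\}\cup\{P_{i,j}: i\in\{3,4\},1\le j\le5\}\cup\{P_{6,1}\}$ and $H=\{H_{i,j}: 2\le i\le 5, 1\le j\le 5\}$. Second indices $j$ (of the vertices with first index $2,\dots,5$) are taken modulo 5 with representatives $1,\dots,5$. The edges are, for all $1\le j\le5$: $\{P_{1,1},H_{2,j}\}$, $\{P_{6,1},H_{5,j}\}$, $\{H_{2,j},H_{2,j+1}\}$, $\{H_{5,j},H_{5,j+1}\}$, $\{H_{3,j},P_{3,j}\}$, $\{P_{3,j},H_{3,j+1}\}$, $\{H_{4,j},P_{4,j+1}\}$, $\{P_{4,j},H_{4,j}\}$, $\{H_{2,j},H_{3,j}\}$, $\{H_{2,j},P_{3,j-1}\}$,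 $\{H_{2,j},P_{3,j}\}$, $\{H_{3,j},P_{4,j}\}$, $\{H_{3,j},H_{4,j-1}\}$, $\{H_{3,j},H_{4,j}\}$, $\{P_{3,j},H_{4,j}\}$, $\{H_{4,j},H_{5,j}\}$, $\{P_{4,j},H_{5,j}\}$, $\{P_{4,j},H_{5,j-1}\}$. *)

(* Defs.v *)
From HB Require Import structures.
From mathcomp Require Import all_boot all_order all_algebra.

Set Implicit Arguments.
Unset Strict Implicit.
Unset Printing Implicit Defensive.

Import GRing.Theory.

Record sgraph := SGraph {
  svertex :> finType;
  sedge : rel svertex;
  sedge_sym : symmetric sedge;
  sedge_irrefl : irreflexive sedge }.

Section IdentifyingCodes.
Variable G : sgraph.

Definition neighbors (v : G) : {set G} := [set w | sedge v w].

Definition closed_neighbors (v : G) : {set G} := v |: neighbors v.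

Definition is_ICS (C : {set G}) : bool :=
  [forall v : G, closed_neighbors v :&: C != set0] &&
  [forall v : G, forall w : G,
     (v != w) ==> (closed_neighbors v :&: C != closed_neighbors w :&: C)].

Definition is_MICS (C : {set G}) : bool :=
  is_ICS C && [forall D : {set G}, is_ICS D ==> (#|C| <= #|D|)].

End IdentifyingCodes.

(* [P11], [P61] are P_{1,1}, P_{6,1}, while [P3 j], [P4 j], [H2 j], ..., [H5 j]
   are P_{3,j}, P_{4,j}, H_{2,j}, ..., H_{5,j}.  The second index lives in 'Z_5,
   so that j + 1 and j - 1 below wrap around and the representative 5 is 0. *)
Inductive sbg_vertex : predArgType :=
  | P11
  | P3 of 'Z_5
  | P4 of 'Z_5
  | P61
  | H2 of 'Z_5
  | H3 of 'Z_5
  | H4 of 'Z_5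
  | H5 of 'Z_5.

Definition sbg_encode (v : sbg_vertex) : bool + 'I_6 * 'Z_5 :=
  match v with
  | P11 => inl false
  | P61 => inl true
  | P3 j => inr (inord 0, j)
  | P4 j => inr (inord 1, j)
  | H2 j => inr (inord 2, j)
  | H3 j => inr (inord 3, j)
  | H4 j => inr (inord 4, j)
  | H5 j => inr (inord 5, j)
  end.

Definition sbg_decode (c : bool + 'I_6 * 'Z_5) : sbg_vertex :=
  match c with
  | inl b => if b then P61 else P11
  | inr (i, j) =>
      match val i with
      | 0 => P3 j | 1 => P4 j | 2 => H2 j | 3 => H3 j | 4 => H4 j | _ => H5 j
      end
  end.

Lemma sbg_encodeK : cancel sbg_encode sbg_decode.
Proof. by case=> //= j; rewrite inordK. Qed.

HB.instance Definition _ := Finite.copy sbg_vertex (can_type sbg_encodeK).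

(* Every edge of the graph in exactly one of its two orientations. *)
Definition sbg_arc (u v : sbg_vertex) : bool :=
  match u, v with
  | P11, H2 _ => true
  | P61, H5 _ => true
  | H2 j, H2 k => k == (j + 1)%R
  | H5 j, H5 k => k == (j + 1)%R
  | H3 j, P3 k => k == j
  | P3 j, H3 k => k == (j + 1)%R
  | H4 j, P4 k => k == (j + 1)%R
  | P4 j, H4 k => k == j
  | H2 j, H3 k => k == j
  | H2 j, P3 k => (k == (j - 1)%R) || (k == j)
  | H3 j, P4 k => k == j
  | H3 j, H4 k => (k == (j - 1)%R) || (k == j)
  | P3 j, H4 k => k == j
  | H4 j, H5 k => k == j
  | P4 j, H5 k => (k == j) || (k == (j - 1)%R)
  | _, _ => false
  end.

Definition sbg_adj : rel sbg_vertex := [rel u v | sbg_arc u v || sbg_arc v u].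

Lemma sbg_adj_sym : symmetric sbg_adj.
Proof. by move=> u v; apply: orbC. Qed.

Lemma sbg_adj_irrefl : irreflexive sbg_adj.
Proof.
have succ_neq (j : 'Z_5) : (j == j + 1)%R = false.
  by rewrite eq_sym -subr_eq0 addrAC subrr add0r.
by case=> // j; rewrite /sbg_adj /= succ_neq.
Qed.

Definition SBG : sgraph := SGraph sbg_adj_sym sbg_adj_irrefl.

Lemma card_SBG : #|SBG| = 32.
Proof.
have bij_enc : bijective sbg_encode.
  exists sbg_decode; first exact: sbg_encodeK.
  case=> [[]|[[i lti] j]] //=.
  by case: i lti => [|[|[|[|[|[|i]]]]]] lti //=; congr (inr (_, _));
    apply: val_inj; rewrite /= inordK.
by rewrite (bij_eq_card bij_enc) card_sum card_prod card_bool !card_ord.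
Qed.

(* Main.v *)
(* Write f v = N^+(v) :&: C.  The f v are nonempty and distinct, so at most
   #|C| of them are singletons, and double counting gives
   2 * 32 <= sum_v (#|f v| + [#|f v| = 1]) <= sum_(c in C) (#|N^+(c)| + 1)
          <= 8 * #|C|.
   For #|C| <= 8 all of these are equalities: every #|f v| is at most 2, so two
   codewords lie together in at most one closed neighbourhood, and C consists of
   hexagons.  In particular no two codewords a, b are adjacent (f a and f b would
   both contain {a, b}), so f c = {c} for c in C, and the pentagon P11, which is
   not in C, has two codewords among its neighbours.  But any two neighbours of
   P11 also lie in the closed neighbourhood of some hexagon H2 i. *)
Require Import Defs.
From mathcomp Require Import all_boot all_order all_algebra.

Set Implicit Arguments.
Unset Strict Implicit.
Unset Printing Implicit Defensive.

Import GRing.Theory.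

Section DoubleCounting.
Variables (G : sgraph) (C : {set G}).

Let f (v : G) := closed_neighbors v :&: C.

Lemma closed_neighborsE (v w : G) :
  (w \in closed_neighbors v) = (w == v) || sedge v w.
Proof. by rewrite !inE. Qed.

Lemma closed_neighbors_refl (v : G) : v \in closed_neighbors v.
Proof. by rewrite closed_neighborsE eqxx. Qed.

Lemma closed_neighbors_sym (v w : G) :
  (w \in closed_neighbors v) = (v \in closed_neighbors w).
Proof. by rewrite !closed_neighborsE eq_sym sedge_sym. Qed.

Lemma ICS_code_neq0 v : is_ICS C -> f v != set0.
Proof. by case/andP=> /forallP/(_ v). Qed.

Lemma ICS_code_inj : is_ICS C -> injective f.
Proof.
case/andP=> _ /forallP sepC v w eq_f; apply/eqP; apply: contraT => neq_vw.
by have /forallP/(_ w)/implyP/(_ neq_vw) := sepC v; rewrite -/(f v) eq_f eqxx.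
Qed.

Lemma sum_card_code :
  \sum_v #|f v| = \sum_(c in C) #|closed_neighbors c|.
Proof.
under eq_bigr => v _ do rewrite -sum1_card.
rewrite (exchange_big_dep (mem C)) /=; last by move=> v c _ /setIP[].
apply: eq_bigr => c cC; rewrite -sum1_card; apply: eq_bigl => v.
by rewrite in_setI cC andbT closed_neighbors_sym.
Qed.

Lemma card_singleton_code : is_ICS C -> \sum_v (#|f v| == 1) <= #|C|.
Proof.
move=> icsC; rewrite -big_mkcond sum1_card.
rewrite -(card_imset _ (ICS_code_inj icsC)) -(card_imset C set1_inj).
apply/subset_leq_card/subsetP=> _ /imsetP[v /cards1P[c fvc] ->].
by rewrite fvc imset_f //; have /setIP[] : c \in f v by rewrite fvc set11.
Qed.

(** The indicator lifts the only sizes below 2 that occur, namely the singletons. *)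
Lemma ICS_weight_ge2 v : is_ICS C -> 2 <= #|f v| + (#|f v| == 1).
Proof. by move/(ICS_code_neq0 v); rewrite -card_gt0; case: #|f v| => [|[]]. Qed.

Lemma ICS_weight_sum_le : is_ICS C ->
  \sum_v (#|f v| + (#|f v| == 1)) <= \sum_(c in C) #|closed_neighbors c|.+1.
Proof.
move=> icsC; rewrite big_split /= sum_card_code.
under [leqRHS]eq_bigr => c _ do rewrite -addn1.
by rewrite [leqRHS]big_split /= sum1_card leq_add2l card_singleton_code.
Qed.

(** The last hypothesis closes the chain of inequalities into a cycle, so both termwise bounds [lo]
    and [hi] are attained at every index. *)
Lemma ICS_tight d : is_ICS C -> (forall v : G, #|closed_neighbors v| <= d) ->
    d.+1 * #|C| <= 2 * #|G| ->
  (forall v, #|f v| <= 2) /\ {in C, forall c, #|closed_neighbors c| = d}.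
Proof.
move=> icsC le_d le_C.
have le_w := ICS_weight_sum_le icsC.
have lo : \sum_(v : G) 2 <= \sum_v (#|f v| + (#|f v| == 1))
          ?= iff [forall v, 2 == #|f v| + (#|f v| == 1)].
  by apply: leqif_sum => v _; split=> //; apply: ICS_weight_ge2.
have hi : \sum_(c in C) #|closed_neighbors c|.+1 <= \sum_(c in C) d.+1
          ?= iff [forall (c | c \in C), #|closed_neighbors c|.+1 == d.+1].
  by apply: leqif_sum => c _; split=> //; rewrite ltnS.
have le_ends : \sum_(c in C) d.+1 <= \sum_(v : G) 2.
  by rewrite !sum_nat_const [leqLHS]mulnC [leqRHS]mulnC.
split=> [v | c cC].
  have := lo.2; rewrite eqn_leq lo.1 (leq_trans le_w (leq_trans hi.1 le_ends)).
  by move/esym/forallP/(_ v)/eqP ->; rewrite leq_addr.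
have := hi.2; rewrite eqn_leq hi.1 (leq_trans le_ends (leq_trans lo.1 le_w)).
by move/esym/forallP/(_ c)/implyP/(_ cC)/eqP=> [].
Qed.

(** A set of size at most 2 containing [a] and [b] is [[set a; b]], so [f u = f v]. *)
Lemma code_pair_separates (a b u v : G) :
    is_ICS C -> (forall w, #|f w| <= 2) -> a != b ->
  a \in f u -> b \in f u -> a \in f v -> b \in f v -> u = v.
Proof.
move=> icsC le2 neq_ab au bu av bv; apply: ICS_code_inj => //.
have pairE w : a \in f w -> b \in f w -> f w = [set a; b].
  move=> aw bw; apply/esym/eqP.
  by rewrite eqEcard subUset !sub1set aw bw cards2 neq_ab le2.
exact: etrans (pairE u au bu) (esym (pairE v av bv)).
Qed.

Lemma ICS_code_self (c : G) :
  is_ICS C -> (forall w, #|f w| <= 2) -> c \in C -> f c = [set c].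
Proof.
move=> icsC le2 cC; apply/setP=> b; rewrite in_set1.
apply/idP/eqP=> [bfc | ->]; last by rewrite in_setI closed_neighbors_refl.
apply/eqP; apply: contraT => neq_bc; case/setIP: (bfc) => bNc bC.
suff eq_bc : b = c by rewrite eq_bc eqxx in neq_bc.
apply: (@code_pair_separates b c) => //;
  by rewrite in_setI ?closed_neighbors_refl // closed_neighbors_sym bNc.
Qed.

(** If [f v = [set c]], then [f v = f c], and injectivity makes [v] the codeword [c]. *)
Lemma ICS_noncode_card_gt1 (v : G) :
  is_ICS C -> (forall w, #|f w| <= 2) -> v \notin C -> 1 < #|f v|.
Proof.
move=> icsC le2; apply: contraNltn => le1.
have /cards1P[c fvc] : #|f v| == 1 by rewrite eqn_leq le1 card_gt0 ICS_code_neq0.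
have /setIP[_ cC] : c \in f v by rewrite fvc set11.
by rewrite (ICS_code_inj icsC (etrans fvc (esym (ICS_code_self icsC le2 cC)))).
Qed.

End DoubleCounting.

Section SoccerBall.
Local Open Scope ring_scope.

(** Five entries for a pentagon and six for a hexagon. Only upper bounds on neighbourhoods are
    needed, so it suffices that every neighbour is listed. *)
Definition sbg_neighbor_seq (v : sbg_vertex) : seq sbg_vertex :=
  match v with
  | P11 => [seq H2 j | j <- enum 'Z_5]
  | P61 => [seq H5 j | j <- enum 'Z_5]
  | P3 j => [:: H2 j; H2 (j + 1); H3 j; H3 (j + 1); H4 j]
  | P4 j => [:: H3 j; H4 j; H4 (j - 1); H5 j; H5 (j - 1)]
  | H2 j => [:: P11; H2 (j + 1); H2 (j - 1); H3 j; P3 (j - 1); P3 j]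
  | H3 j => [:: H2 j; P3 j; P3 (j - 1); P4 j; H4 (j - 1); H4 j]
  | H4 j => [:: P4 j; P4 (j + 1); H3 j; H3 (j + 1); P3 j; H5 j]
  | H5 j => [:: P61; H5 (j + 1); H5 (j - 1); H4 j; P4 j; P4 (j + 1)]
  end.

Lemma sbg_adj_neighbor_seq v w : sbg_adj v w -> w \in sbg_neighbor_seq v.
Proof.
case: v w => [|j|j||j|j|j|j] [|k|k||k|k|k|k] //=; rewrite /sbg_adj /= ?orbF;
  try (by move=> _; rewrite map_f ?mem_enum);
  (* For an arc from [w] to [v], the index shift has to be inverted. *)
  by do ?[case/orP]; do ?[move/eqP->]; rewrite !inE ?addrK ?subrK ?eqxx ?orbT.
Qed.

Lemma card_SBG_closed_neighbors (v : SBG) :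
  (#|closed_neighbors v| <= (size (sbg_neighbor_seq v)).+1)%N.
Proof.
apply: leq_trans (card_size (v :: sbg_neighbor_seq v)).
apply/subset_leq_card/subsetP=> w; rewrite closed_neighborsE inE.
by case/orP=> [-> // | /sbg_adj_neighbor_seq->]; rewrite orbT.
Qed.

Lemma size_sbg_neighbor_seq v : (size (sbg_neighbor_seq v) <= 6)%N.
Proof. by case: v => //=; rewrite size_map -cardE card_ord. Qed.

(** Two subsets of size 3 in a set of size 5 must meet. *)
Lemma Z5_common_neighbor (j k : 'Z_5) :
  exists i : 'Z_5, (i \in [:: j; j + 1; j - 1]) && (i \in [:: k; k + 1; k - 1]).
Proof.
case: j => -[|[|[|[|[|//]]]]] ltj; case: k => -[|[|[|[|[|//]]]]] ltk;
  first [ by exists 0 | by exists 1 | by exists 2%:R | by exists 3%:R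
        | by exists 4%:R ].
Qed.

Lemma H2_closed_neighbors (i j : 'Z_5) :
  i \in [:: j; j + 1; j - 1] -> (H2 j : SBG) \in closed_neighbors (H2 i : SBG).
Proof.
rewrite closed_neighborsE !inE /= /sbg_adj /=.
by case/or3P=> /eqP->; rewrite ?subrK eqxx ?orbT.
Qed.

Lemma P11_closed_neighbors (v : SBG) :
  v \in closed_neighbors (P11 : SBG) -> v != P11 -> exists j, v = H2 j.
Proof.
by rewrite closed_neighborsE => /orP[-> // | ]; case: v => // j; exists j.
Qed.

Lemma SBG_ICS_card (C : {set SBG}) : is_ICS C -> (8 < #|C|)%N.
Proof.
move=> icsC; rewrite ltnNge; apply/negP=> leC8.
have le7 (v : SBG) : (#|closed_neighbors v| <= 7)%N.
  by apply: leq_trans (card_SBG_closed_neighbors v) _; apply: size_sbg_neighbor_seq.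
have [|le2 eq7] := ICS_tight icsC le7.
  (* Here [d] is 7, and 2 * 32 = 8 * 8. *)
  by rewrite card_SBG (leq_mul2l 8 _ 8).
(* A pentagon has a closed neighbourhood of size at most 6, not 7. *)
have P11nC : (P11 : SBG) \notin C.
  apply/negP=> /eq7 card7; have := card_SBG_closed_neighbors (P11 : SBG).
  by rewrite card7 /= size_map -cardE card_ord.
have /card_gt1P[a [b [aP bP neq_ab]]] := ICS_noncode_card_gt1 icsC le2 P11nC.
case/setIP: (aP) (bP) => aN aC /setIP[bN bC].
have [j aE] := P11_closed_neighbors aN (memPn P11nC _ aC).
have [k bE] := P11_closed_neighbors bN (memPn P11nC _ bC).
have [i /andP[ij ik]] := Z5_common_neighbor j k.
(* Both [a] and [b] lie in the closed neighbourhoods of [P11] and of [H2 i], which are distinct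
   vertices. *)
suff: P11 = H2 i by [].
apply: (code_pair_separates icsC le2 neq_ab aP bP).
  by rewrite in_setI aC aE H2_closed_neighbors.
by rewrite in_setI bC bE H2_closed_neighbors.
Qed.

End SoccerBall.

Theorem theorem3 :
  (forall C : {set SBG}, is_MICS C -> 9 <= #|C|) /\
  (forall C : {set SBG}, #|C| <= 8 -> ~~ is_ICS C).
Proof.
split=> [C /andP[/SBG_ICS_card //] | C].
by apply: contraTN => /SBG_ICS_card; rewrite ltnNge.
Qed.
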